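(* Let $N>2$, $\lambda>0$, let $h=(h_n)_{n\in\mathbb{Z}}$ be a real absolutely summable sequence with frequency response $H(\omega)=\sum_n h_n e^{-\mathrm{j}\omega n}$ (where $\mathrm{j}^2=-1$), and let $H$ be the convolution operator that sends $x\in\mathbb{R}^N$ to the sequence $[Hx]_n=\sum_{k=1}^N h_{n-k}\,x_k$, $n\in\mathbb{Z}$. Let $y$ be a real square-summable sequence indexed by $\mathbb{Z}$. Let $\psi(\,\cdot\,;a)\colon\mathbb{R}^2\to\mathbb{R}$, $a=(a_1,a_2)$, be the bivariate penalty defined in the context from a univariate penalty $\phi$ satisfying properties P1–P10, and define $F\colon\mathbb{R}^N\to\mathbb{R}$ by $$F(x)=\tfrac12\|y-Hx\|_2^2+\frac{\lambda}{2}\sum_{n=1}^{N+1}\psi\big((x_{n-1},x_n);a\big),\qquad x_0:=0,\ x_{N+1}:=0.$$ Let $p_0,p_1\in\mathbb{R}$ and suppose $P(\omega)=p_0+2p_1\cos(\omega)$ satisfies $$0\le P(\omega)\le |H(\omega)|^2\qquad\text{for all }\omega\in\mathbb{R}.$$ If $0\le a_1\le P(0)/\lambda$ and $0\le a_2\le P(\pi)/\lambda$, then $F$ is convex.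
   Context: $\|\cdot\|_2$ is the $\ell_2$ norm of sequences. (If $h$ has finite support, $Hx$ is supported on a finite index set and $H$ is a finite Toeplitz matrix.) Univariate penalty: a family of functions $\phi(\,\cdot\,;a)\colon \mathbb{R}\to\mathbb{R}$, indexed by $a \ge 0$, with the following properties for all $a\ge 0$ (derivatives $\phi',\phi''$ are with respect to $t$; $0^+$ denotes the right-hand limit at $0$): P1) $\phi(\,\cdot\,;a)$ is continuous on $\mathbb{R}$; P2) $\phi(\,\cdot\,;a)$ is twice continuously differentiable, increasing and concave on $\mathbb{R}_+ = (0,\infty)$; P3) $\phi(0;a)=0$; P4) $\phi(t;0)=|t|$; P5) $\phi(-t;a)=\phi(t;a)$; P6) $\phi'(0^+;a)=1$; P7) $\phi''(0^+;a)=-a$; P8) $\phi''(t;a)\ge -a$ for all $t\ne 0$; P9) for each $t$, $\phi(t;a)$ is decreasing (non-strictly) and convex in $a$; P10) $\phi(t;a) = (b/a)\,\phi(at/b;b)$ for all $a,b>0$. Define $s(t;a)=\phi(t;a)-|t|$. Bivariate function $S$: let $a=(a_1,a_2)$ with $a_i\ge 0$. If at least one $a_i$ is non-zero, put $\alpha = \frac{a_1+a_2}{2}$, $r=\frac{a_1-a_2}{a_1+a_2}$, and define $S(\,\cdot\,;a)\colon\mathbb{R}^2\to\mathbb{R}$ by $$S(x;a)=\begin{cases} s(x_1+rx_2;\alpha)+(1-r)\,s(x_2;a_1), & x\in A_1\\ s(rx_1+x_2;\alpha)+(1-r)\,s(x_1;a_1), & x\in A_2\\ s(rx_1+x_2;\alpha)+(1+r)\,s(x_1;a_2),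 & x\in A_3\\ s(x_1+rx_2;\alpha)+(1+r)\,s(x_2;a_2), & x\in A_4\end{cases}$$ where $A_1=\{x: x_2(x_1-x_2)\ge 0\}$, $A_2=\{x: x_1(x_1-x_2)\le 0\}$, $A_3=\{x: x_1(x_1+x_2)\le 0\}$, $A_4=\{x: x_2(x_1+x_2)\le 0\}$ (the formulas agree on overlaps). If $a_1=a_2=0$, $S(x;0)=0$. Bivariate penalty: $\psi(x;a)=S(x;a)+\|x\|_1$, where $\|x\|_1=|x_1|+|x_2|$. *)

(* Defs.v *)
From HB Require Import structures.
From mathcomp Require Import all_boot all_order all_algebra.
From mathcomp Require Import all_classical all_reals all_analysis.
From mathcomp Require Import complex.

Set Implicit Arguments.
Unset Strict Implicit.
Unset Printing Implicit Defensive.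

Import Order.TTheory GRing.Theory Num.Theory.
Import numFieldNormedType.Exports.

Local Open Scope classical_set_scope.
Local Open Scope ring_scope.
Local Open Scope complex_scope.

Section Sequences.
Context {R : realType}.

Definition abs_summable (u : int -> R) : Prop :=
  summable [set: int] (EFin \o u).

Definition sq_summable (u : int -> R) : Prop :=
  summable [set: int] (fun n => (u n ^+ 2)%:E).

(* Meaningful for square-summable u only: fine sends +oo to 0. *)
Definition l2norm (u : int -> R) : R :=
  Num.sqrt (fine (\esum_(n in [set: int]) (u n ^+ 2)%:E)).

(* Sum over the integers of an absolutely summable family: the unordered sum
   of the positive parts minus that of the negative parts. *)
Definition sumZ (u : int -> R) : R :=
  fine (\esum_(n in [set: int]) (EFin \o u)^\+%E n) -
  fine (\esum_(n in [set: int]) (EFin \o u)^\-%E n).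

Definition csumZ (u : int -> R[i]) : R[i] :=
  sumZ (fun n => complex.Re (u n)) +i* sumZ (fun n => complex.Im (u n)).

(* exp (j theta), by Euler's formula *)
Definition expi (theta : R) : R[i] := cos theta +i* sin theta.

Definition freq_response (h : int -> R) (w : R) : R[i] :=
  csumZ (fun n => (h n)%:C * expi (- (w * n%:~R))).

(* The coordinate x_k, 1 <= k <= N, is the entry of index k - 1 of x. *)
Definition convolution (h : int -> R) N (x : 'rV[R]_N) (n : int) : R :=
  \sum_(k < N) h (n - k.+1%:Z) * x ord0 k.

(* x_n for 1 <= n <= N, and 0 for every other n. *)
Definition zero_pad N (x : 'rV[R]_N) (n : nat) : R :=
  match n with
  | 0%N => 0
  | k.+1 => if insub k is Some i then x ord0 (i : 'I_N) else 0
  end.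

Definition trig_poly1 (p0 p1 w : R) : R := p0 + 2 * p1 * cos w.

End Sequences.

Section Penalties.
Context {R : realType}.

(* phi a t stands for phi(t; a); only the values of phi at a >= 0 matter. *)
Record univariate_penalty (phi : R -> R -> R) : Prop := UnivariatePenalty {
  pen_continuous : forall a : R, 0 <= a -> continuous (phi a);
  pen_derivable : forall a : R, 0 <= a ->
    forall t : R, 0 < t -> derivable (phi a) t 1;
  pen_derivable2 : forall a : R, 0 <= a ->
    forall t : R, 0 < t -> derivable ((phi a)^`())%classic t 1;
  pen_continuous2 : forall a : R, 0 <= a ->
    forall t : R, 0 < t -> {for t, continuous ((phi a)^`(2))%classic};
  pen_increasing : forall a : R, 0 <= a ->
    forall s t : R, 0 < s -> s <= t -> phi a s <= phi a t;
  pen_concave : forall a : R, 0 <= a ->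
    convex_function (`]0, +oo[%classic : set (convex_lmodType R^o))
      (fun t => - phi a t);
  pen_at0 : forall a : R, 0 <= a -> phi a 0 = 0;
  pen_abs : forall t : R, phi 0 t = `|t|;
  pen_even : forall a : R, 0 <= a -> forall t : R, phi a (- t) = phi a t;
  pen_d1_0 : forall a : R, 0 <= a -> ((phi a)^`())%classic t @[t --> 0^'+] --> (1 : R);
  pen_d2_0 : forall a : R, 0 <= a -> ((phi a)^`(2))%classic t @[t --> 0^'+] --> - a;
  pen_d2_ge : forall a : R, 0 <= a -> forall t : R, t != 0 -> - a <= ((phi a)^`(2))%classic t;
  pen_decreasing_param : forall t a b : R, 0 <= a -> a <= b -> phi b t <= phi a t;
  pen_convex_param : forall t : R,
    convex_function (`[0, +oo[%classic : set (convex_lmodType R^o))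
      (fun a => phi a t);
  pen_scale : forall a b : R, 0 < a -> 0 < b ->
    forall t : R, phi a t = (b / a) * phi b (a * t / b)
}.

Definition pen_s (phi : R -> R -> R) (a t : R) : R := phi a t - `|t|.

(* The regions A1, A2, A3, A4 are tested in this order; they cover the plane,
   and for a penalty phi the formulas agree where regions overlap. *)
Definition bivariate_S (phi : R -> R -> R) (a1 a2 x1 x2 : R) : R :=
  if (a1 == 0) && (a2 == 0) then 0 else
  let alpha := (a1 + a2) / 2 in
  let r := (a1 - a2) / (a1 + a2) in
  let s t a := pen_s phi a t in
  if 0 <= x2 * (x1 - x2) then s (x1 + r * x2) alpha + (1 - r) * s x2 a1
  else if x1 * (x1 - x2) <= 0 then s (r * x1 + x2) alpha + (1 - r) * s x1 a1
  else if x1 * (x1 + x2) <= 0 then s (r * x1 + x2) alpha + (1 + r) * s x1 a2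
  else s (x1 + r * x2) alpha + (1 + r) * s x2 a2.

Definition bivariate_penalty (phi : R -> R -> R) (a1 a2 x1 x2 : R) : R :=
  bivariate_S phi a1 a2 x1 x2 + (`|x1| + `|x2|).

Definition objective (phi : R -> R -> R) (lambda a1 a2 : R) (h y : int -> R)
    N (x : 'rV[R]_N) : R :=
  1 / 2 * l2norm (fun n => y n - convolution h x n) ^+ 2 +
  lambda / 2 * \sum_(1 <= n < N.+2)
    bivariate_penalty phi a1 a2 (zero_pad x n.-1) (zero_pad x n).

End Penalties.

(* Main.v *)
Require Import Defs.
From HB Require Import structures.
From mathcomp Require Import all_boot all_order all_algebra.
From mathcomp Require Import all_classical all_reals all_analysis.
From mathcomp Require Import complex finmap zify ring lra.

Import Order.TTheory GRing.Theory Num.Theory.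
Import numFieldNormedType.Exports.
Local Open Scope classical_set_scope.
Local Open Scope ring_scope.

(** The data term can lend curvature to the penalty. Write [A = P 0],
    [B = P pi]; then [P w = A * (1 + cos w) / 2 + B * (1 - cos w) / 2], that is,
    [P w = A / 4 * |1 + z|^2 + B / 4 * |1 - z|^2] with [z = expi (- w)]. By
    Parseval, the bound [P <= |H|^2] says that
        |H x|^2 >= sum_n pair_form A B (x_(n-1)) (x_n)
    ([convolution_energy_ge]). Hence half of the data term minus half of that
    quadratic form is convex in [x], and what has to be shown is that each
    function [pair_form A B u v + lambda * psi (u, v)] of two variables is
    convex. As [lambda * a1 <= A] and [lambda * a2 <= B], it is enough that
    [S + pair_form a1 a2] is convex ([le_chord_bivariate_quad]); the l1 norm
    contained in [psi] is convex anyway.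

    For the bivariate part, put [q a t = phi a t - |t| + a / 2 * t ^ 2]. The
    penalty axioms make [q a] convex, even and flat at 0, and the scaling axiom
    makes its derivative at [t] a function of [a * t] only
    ([penalty_quad_support]). On each of the four regions that define [S], the
    function [S + pair_form a1 a2] is the sum of a multiple of [q alpha] at a
    linear form and a multiple of [q a1] or [q a2] at a coordinate, so it is the
    restriction of a convex function on the plane ([bivariate_quad_piece],
    [piece_support]). On the overlaps the values and the slopes of these pieces
    agree ([piece_agree]), because the slopes depend on the product of parameter
    and argument only. So the function has a local supporting line at each point
    of each line of the plane, which together with continuity gives convexity
    ([le_chord_piecewise]).

    For the Parseval part, integrals are avoided: the filter [h] is cut off
    outside a window that carries all of its l1 norm up to [eps], which turns
    the convolution into a product of polynomials, and for polynomials the mean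
    of the squared modulus over sufficiently many roots of unity is the sum of
    the squared coefficients ([discrete_parseval]). The cut-off changes both
    sides by a multiple of [eps] ([freq_response_window], [window_energy_le]). *)

(** * Convexity on the line from local supporting lines *)

(** If the graph rose above the chord, then [f] minus the chord, minus a small
    concave parabola vanishing at 0 and 1, would still have a positive maximum
    at some interior point. A local supporting line of [f] there contradicts
    maximality on one of the two sides, because of the strict concavity of the
    subtracted parabola. *)
Lemma le_chord_of_local_support (R : realType) (f : R -> R) :
  continuous f ->
  (forall c, exists D, \forall x \near c, f c + D * (x - c) <= f x) ->
  forall t, 0 <= t <= 1 -> f t <= t * f 1 + (1 - t) * f 0.
Proof.
move=> cf supp t /andP[t0 t1]; rewrite leNgt; apply/negP => lt_chord.
have {t0}t0 : 0 < t.
  rewrite lt_neqAle t0 andbT; apply: contraTneq lt_chord => <-.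
  by rewrite -leNgt mul0r add0r subr0 mul1r.
have {t1}t1 : t < 1.
  rewrite lt_neqAle t1 andbT; apply: contraTneq lt_chord => ->.
  by rewrite -leNgt mul1r subrr mul0r addr0.
pose gap := f t - (t * f 1 + (1 - t) * f 0).
pose g x := f x - (x * f 1 + (1 - x) * f 0) - gap * x * (1 - x).
have gap0 : 0 < gap by rewrite subr_gt0.
have g_t : 0 < g t.
  have : t * (1 - t) < 1 by nra.
  by rewrite /g -/gap; nra.
have cg : {within `[0, 1], continuous g}.
  apply: continuous_subspaceT => x.
  have cid : id @ x --> x by exact: cvg_id.
  have c1id : (fun u => 1 - u) @ x --> 1 - x by apply: cvgB cid; exact: cvg_cst.
  apply: cvgB; last by apply: cvgM c1id; apply: cvgM cid; exact: cvg_cst.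
  apply: cvgB; first exact: cf.
  by apply: cvgD; [apply: cvgM cid _|apply: cvgM c1id _]; exact: cvg_cst.
have [c c01 gmax] := EVT_max (@ler01 R) cg.
have gc : 0 < g c.
  by apply: (lt_le_trans g_t); apply: gmax; rewrite in_itv/= !ltW.
have {c01}[c0 c1] : 0 < c /\ c < 1.
  move: c01; rewrite in_itv/= => /andP[c0 c1]; split.
    rewrite lt_neqAle c0 andbT; apply: contraTneq gc => <-.
    by rewrite -leNgt /g; lra.
  rewrite lt_neqAle c1 andbT; apply: contraTneq gc => ->.
  by rewrite -leNgt /g; lra.
have [D /nbhs_ballP[e /= e0 De]] := supp c.
pose d := Num.min (e / 2) (Num.min c (1 - c)).
have d0 : 0 < d by rewrite !lt_min c0 divr_gt0//= subr_gt0.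
have [de [dc d1]] : d <= e / 2 /\ d <= c /\ d <= 1 - c.
  by rewrite /d !ge_min !lexx !orbT.
have Dr : f c + D * (c + d - c) <= f (c + d).
  apply: De; rewrite /ball /= opprD addrA subrr add0r normrN gtr0_norm//; lra.
have Dl : f c + D * (c - d - c) <= f (c - d).
  apply: De; rewrite /ball /= opprB addrCA subrr addr0 gtr0_norm//; lra.
have gr : g (c + d) <= g c by apply: gmax; rewrite in_itv/=; lra.
have gl : g (c - d) <= g c by apply: gmax; rewrite in_itv/=; lra.
(* Adding the two inequalities at c - d and c + d cancels D and leaves
   2 * gap * d ^ 2 <= 0. *)
have : 0 < gap * d * d by rewrite !mulr_gt0.
by move: gr gl Dr Dl; rewrite /g; nra.
Qed.

(** A function glued from finitely many pieces [p i] on closed sets [l i <= 0].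
    The slopes [D i] support the pieces everywhere and coincide where regions
    meet. Near [c] only regions that contain [c] itself are visited, so the
    common slope at [c] supports [f] locally. *)
Lemma le_chord_piecewise (R : realType) (I : finType) (f : R -> R)
    (l p D : I -> R -> R) :
  (forall i, continuous (l i)) -> (forall i, continuous (p i)) ->
  (forall x, exists i, l i x <= 0) ->
  (forall i x, l i x <= 0 -> f x = p i x) ->
  (forall i j x, l i x <= 0 -> l j x <= 0 -> D i x = D j x) ->
  (forall i c x, p i c + D i c * (x - c) <= p i x) ->
  forall t, 0 <= t <= 1 -> f t <= t * f 1 + (1 - t) * f 0.
Proof.
move=> cl cp cover fp DD supp.
have loc c : \forall x \near c, forall i, l i x <= 0 -> l i c <= 0.
  near=> x; move=> i; move: i; near: x; apply: filter_forall => i.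
  have [lc|lc] := leP (l i c) 0; first by near=> x.
  have : \forall x \near c, 0 < l i x by exact: (cvgr_gt (l i c) (cl i c)).
  by apply: filterS => x lx; rewrite leNgt lx.
apply: le_chord_of_local_support => c; last first.
  have [i ic] := cover c; exists (D i c).
  near=> x.
  have [j jx] := cover x.
  have jc : l j c <= 0 by apply: (near (loc c) x) jx.
  by rewrite (fp j)// (fp j x)// (DD i j).
apply/cvgrPdist_le => e e0.
have near_p : \forall x \near c, forall i, `|p i c - p i x| <= e.
  near=> x; move=> i; move: i; near: x; apply: filter_forall => i.
  by move/cvgrPdist_le : (cp i c); exact.
near=> x.
have [j jx] := cover x.
have jc : l j c <= 0 by apply: (near (loc c) x) jx.
by rewrite (fp j)// (fp j x)//; apply: (near near_p x).
Unshelve. all: by end_near. Qed.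

(** * The convexified univariate penalty *)

(** The quadratic form of the symmetric matrix with eigenvalue [A / 2] on (1, 1)
    and [B / 2] on (1, -1). *)
Definition pair_form (R : realType) (A B u v : R) : R :=
  A / 4 * (u + v) ^+ 2 + B / 4 * (u - v) ^+ 2.

Section ConvexifiedPenalty.
Context {R : realType}.
Variable phi : R -> R -> R.
Hypothesis phi_penalty : univariate_penalty phi.

(** The derivative, at positive [t], of [phi 1 t - t + t ^ 2 / 2]. *)
Let pos_slope (t : R) : R := (phi 1)^`()%classic t - 1 + t.

Let pos_slope_le (s t : R) : 0 < s -> s <= t -> pos_slope s <= pos_slope t.
Proof.
move=> s0; rewrite le_eqVlt => /predU1P[->//|st].
have Dder (x : R) : 0 < x -> is_derive x 1 pos_slope ((phi 1)^`(2)%classic x + 1).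
  move=> x0; rewrite /pos_slope derive1nS derive1E.
  have /derivableP dx := pen_derivable2 phi_penalty (@ler01 R) x0.
  have -> : 'D_1 ((phi 1)^`())%classic x + 1 =
      'D_1 ((phi 1)^`())%classic x - 0 + 1 by rewrite subr0.
  by apply: is_deriveD; apply: is_deriveB.
have [x /[!in_itv]/= /andP[sx _] De] : exists2 c, c \in `]s, t[%R &
    pos_slope t - pos_slope s = ((phi 1)^`(2)%classic c + 1) * (t - s).
  apply: MVT => // [x /[!in_itv]/= /andP[sx _]|]; first exact/Dder/(lt_trans s0).
  apply: derivable_within_continuous => x /[!in_itv]/= /andP[sx _].
  by case: (Dder x (lt_le_trans s0 sx)).
have x0 : x != 0 by rewrite gt_eqF// (lt_trans s0).
have d2 := pen_d2_ge phi_penalty (@ler01 R) x0.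
by rewrite -subr_ge0 De; rewrite mulr_ge0 ?subr_ge0 ?(ltW st)// -lerBlDr sub0r.
Qed.

(** It increases from its limit 0 at [0^+], which is where [phi' (0^+) = 1] is
    used. *)
Let pos_slope_ge0 (t : R) : 0 < t -> 0 <= pos_slope t.
Proof.
move=> t0; rewrite leNgt; apply/negP => lt_t.
have cvgD : pos_slope x @[x --> 0^'+] --> (1 - 1 + 0 : R).
  apply: cvgD; last exact: cvg_at_right_filter cvg_id.
  apply: cvgB; last exact: cvg_cst.
  exact: pen_d1_0 phi_penalty _ ler01.
have near_gt : \forall x \near 0^'+, pos_slope t < pos_slope x.
  by apply: (cvgr_gt _ cvgD); rewrite subrr addr0.
have [x [/andP[x0 xt]]] : exists x, (0 < x <= t) /\ pos_slope t < pos_slope x.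
  near (0:R)^'+ => x; exists x; split; last by near: x.
  apply/andP; split; near: x; [exact: nbhs_right_gt|exact: nbhs_right_le].
by rewrite ltNge pos_slope_le.
Unshelve. all: by end_near. Qed.

(** The curvature of [phi a] is at least [- a] away from 0 and its kink at 0 is
    that of [|t|]; adding [a / 2 * t ^ 2] and removing the kink leaves a convex
    function. *)
Definition penalty_quad (a t : R) : R := pen_s phi a t + a / 2 * t ^+ 2.

(** The derivative of [penalty_quad 1] on the whole line. By scaling, that of
    [penalty_quad a] at [t] is [penalty_slope (a * t)], for [a = 0] as well. *)
Definition penalty_slope (t : R) : R :=
  if t == 0 then 0 else Num.sg t * ((phi 1)^`()%classic `|t| - 1 + `|t|).

Lemma penalty_slope0 : penalty_slope 0 = 0.
Proof. by rewrite /penalty_slope eqxx. Qed.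

Lemma penalty_slopeN t : penalty_slope (- t) = - penalty_slope t.
Proof.
by rewrite /penalty_slope oppr_eq0; case: eqVneq => [|_];
    rewrite ?oppr0// sgrN normrN mulNr.
Qed.

Lemma penalty_quadN a t : 0 <= a -> penalty_quad a (- t) = penalty_quad a t.
Proof.
by move=> a0; rewrite /penalty_quad /pen_s (pen_even phi_penalty)// normrN sqrrN.
Qed.

Lemma penalty_quad_at0 a : 0 <= a -> penalty_quad a 0 = 0.
Proof.
move=> a0; rewrite /penalty_quad /pen_s (pen_at0 phi_penalty)//.
by rewrite normr0 expr0n/= mulr0 subrr addr0.
Qed.

Lemma penalty_quad0 t : penalty_quad 0 t = 0.
Proof.
by rewrite /penalty_quad /pen_s (pen_abs phi_penalty) !mul0r subrr addr0.
Qed.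

Lemma penalty_quad_scale a t : 0 < a ->
  penalty_quad a t = a^-1 * penalty_quad 1 (a * t).
Proof.
move=> a0; rewrite /penalty_quad /pen_s (pen_scale phi_penalty a0 ltr01).
by rewrite divr1 normrM gtr0_norm//; field; lra.
Qed.

Lemma continuous_penalty_quad a : 0 <= a -> continuous (penalty_quad a).
Proof.
move=> a0 x; apply: cvgD.
  by apply: cvgB; [exact: (pen_continuous phi_penalty)|exact: norm_continuous].
by apply: cvgM; [exact: cvg_cst|exact: exprn_continuous].
Qed.

Let penalty_quad_mvt (s t : R) : 0 <= s -> s < t -> exists2 c, s < c < t &
  penalty_quad 1 t - penalty_quad 1 s = pos_slope c * (t - s).
Proof.
move=> s0 st.
pose g x := phi 1 x - x + 1 / 2 * (x * x).
have gE x : 0 <= x -> penalty_quad 1 x = g x.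
  by move=> x0; rewrite /penalty_quad /pen_s ger0_norm// expr2.
have cg : continuous g.
  move=> x; apply: cvgD.
    by apply: cvgB; [exact: (pen_continuous phi_penalty ler01)|exact: cvg_id].
  by apply: cvgM; [exact: cvg_cst|apply: cvgM; exact: cvg_id].
have dg (x : R) : 0 < x -> is_derive x 1 g (pos_slope x).
  move=> x0; have /derivableP := pen_derivable phi_penalty (@ler01 R) x0.
  rewrite -derive1E => dx.
  have dxx : is_derive x 1 (fun y : R => 1 / 2 * (y * y)) x.
    have -> : (fun y : R => 1 / 2 * (y * y)) = (1 / 2) \*: (id * id).
      by apply/funext => y.
    by apply: is_derive_eq; rewrite /GRing.scale/= mulr1; lra.
  exact: is_deriveD.
rewrite !gE ?(le_trans s0 (ltW st))//.
have [x] : exists2 c, c \in `]s, t[%R & g t - g s = pos_slope c * (t - s).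
  apply: MVT => // [x /[!in_itv]/= /andP[sx _]|].
    exact/dg/(le_lt_trans s0).
  exact: continuous_subspaceT.
by rewrite in_itv/= => ? ?; exists x.
Qed.

Let penalty_quad1_ge0 (t : R) : 0 <= penalty_quad 1 t.
Proof.
wlog t0 : t / 0 <= t.
  move=> H; have [/H//|t0] := leP 0 t.
  by rewrite -penalty_quadN// H// oppr_ge0 ltW.
move: t0; rewrite le_eqVlt => /predU1P[<-|t0]; first by rewrite penalty_quad_at0.
have [x /andP[x0 xt]] := penalty_quad_mvt _ _ (lexx 0) t0.
rewrite penalty_quad_at0// !subr0 => ->.
by rewrite mulr_ge0 ?pos_slope_ge0// ltW.
Qed.

Let support_pos (s t : R) : 0 < s ->
  penalty_quad 1 s + pos_slope s * (t - s) <= penalty_quad 1 t.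
Proof.
move=> s0.
wlog t0 : t / 0 <= t.
  move=> H; have [/H//|t0] := leP 0 t.
  have := H (- t); rewrite oppr_ge0 penalty_quadN// => /(_ (ltW t0)).
  apply: le_trans; rewrite lerD2l ler_wpM2l ?pos_slope_ge0//.
  lra.
have [ts|st|->] := ltgtP t s; last by rewrite subrr mulr0 addr0.
- have [x /andP[tx xs] De] := penalty_quad_mvt _ _ t0 ts.
  have := pos_slope_le _ _ (le_lt_trans t0 tx) (ltW xs).
  nra.
- have [x /andP[sx xt] De] := penalty_quad_mvt _ _ (ltW s0) st.
  have := pos_slope_le _ _ s0 (ltW sx).
  nra.
Qed.

Let support1 (s t : R) :
  penalty_quad 1 s + penalty_slope s * (t - s) <= penalty_quad 1 t.
Proof.
have [->|s0] := eqVneq s 0.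
  by rewrite penalty_slope0 mul0r addr0 penalty_quad_at0// penalty_quad1_ge0.
wlog : s t s0 / 0 < s.
  move=> H; have [sN|/H->//|s_eq0] := ltgtP s 0; last by rewrite s_eq0 eqxx in s0.
  have := H (- s) (- t); rewrite oppr_eq0 oppr_gt0 => /(_ s0 sN).
  by rewrite !penalty_quadN// penalty_slopeN; apply: le_trans; lra.
move=> {}s0; suff -> : penalty_slope s = pos_slope s by exact: support_pos.
by rewrite /penalty_slope gt_eqF// gtr0_sg// gtr0_norm// mul1r.
Qed.

(** Convexity of [penalty_quad a] in the form of supporting lines. For [a = 1]
    and [s > 0] it follows from the monotonicity of the derivative; negative [t]
    are reflected, which only raises the line as its slope is nonnegative.
    Scaling gives the other values of [a]. *)
Lemma penalty_quad_support (a s t : R) : 0 <= a ->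
  penalty_quad a s + penalty_slope (a * s) * (t - s) <= penalty_quad a t.
Proof.
rewrite le_eqVlt => /predU1P[<-|a0].
  by rewrite !penalty_quad0 mul0r penalty_slope0 mul0r addr0.
rewrite !(penalty_quad_scale _ _ a0) -(ler_pM2l a0) mulrDr !mulVKf ?gt_eqF//.
by apply: le_trans (support1 (a * s) (a * t)); rewrite lerD2l; lra.
Qed.

(** * The bivariate function plus its quadratic form *)

(** The parametrisation [a1 = alpha * (1 + r)], [a2 = alpha * (1 - r)] inverts
    the definitions of [alpha] and [r] from [a1] and [a2], so that the
    compatibility of the slopes becomes a polynomial identity. *)
Section Pieces.
Variables (alpha r : R).
Hypothesis alpha_gt0 : 0 < alpha.
Hypotheses (addr_r_ge0 : 0 <= 1 + r) (subr_r_ge0 : 0 <= 1 - r).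

Let a1 := alpha * (1 + r).
Let a2 := alpha * (1 - r).

Let alpha_ge0 : 0 <= alpha. Proof. exact: ltW. Qed.
Let a1_ge0 : 0 <= a1. Proof. exact: mulr_ge0. Qed.
Let a2_ge0 : 0 <= a2. Proof. exact: mulr_ge0. Qed.

(** The four regions are indexed by two booleans: the first one exchanges the
    coordinates, the second one tells the regions bounded by the line [u = v]
    from those bounded by [u = - v]. In this order [(false, true)],
    [(true, true)], [(true, false)], [(false, false)] are the regions A1, A2,
    A3, A4, each of them described by [region_form <= 0]. *)
Definition region_form (b : bool * bool) (u v : R) : R :=
  let x := if b.1 then v else u in let y := if b.1 then u else v in
  if b.2 then y * (y - x) else y * (x + y).

Definition piece (b : bool * bool) (u v : R) : R :=
  let x := if b.1 then v else u in let y := if b.1 then u else v in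
  penalty_quad alpha (x + r * y) +
  (if b.2 then (1 - r) * penalty_quad a1 y else (1 + r) * penalty_quad a2 y).

(** The derivative of [piece b] at [(u, v)] in the direction [(du, dv)]. *)
Definition piece_slope (b : bool * bool) (u v du dv : R) : R :=
  let x := if b.1 then v else u in let y := if b.1 then u else v in
  let dx := if b.1 then dv else du in let dy := if b.1 then du else dv in
  penalty_slope (alpha * (x + r * y)) * (dx + r * dy) +
  (if b.2 then (1 - r) * penalty_slope (a1 * y)
   else (1 + r) * penalty_slope (a2 * y)) * dy.

Lemma piece_support b u v u' v' :
  piece b u v + piece_slope b u v (u' - u) (v' - v) <= piece b u' v'.
Proof.
have H x y x' y' (c : bool) :
  penalty_quad alpha (x + r * y) +
    (if c then (1 - r) * penalty_quad a1 y else (1 + r) * penalty_quad a2 y) +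
  (penalty_slope (alpha * (x + r * y)) * ((x' - x) + r * (y' - y)) +
   (if c then (1 - r) * penalty_slope (a1 * y)
    else (1 + r) * penalty_slope (a2 * y)) * (y' - y)) <=
  penalty_quad alpha (x' + r * y') +
    (if c then (1 - r) * penalty_quad a1 y' else (1 + r) * penalty_quad a2 y').
  rewrite addrACA; apply: lerD.
    have -> : x' - x + r * (y' - y) = (x' + r * y') - (x + r * y) by ring.
    exact: penalty_quad_support.
  case: c; rewrite -mulrA -mulrDr ler_wpM2l ?penalty_quad_support//.
by case: b => [[] c]; apply: H.
Qed.

(** Two regions with the same first boolean meet on a coordinate axis, where
    the terms that distinguish their pieces vanish with their slopes. Two
    regions with the same second boolean meet on a diagonal, where the slopes
    involved are equal up to sign, by [alpha * (1 + r) = a1] on [u = v] and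
    [alpha * (1 - r) = a2] on [u = - v]. Other pairs of regions meet at the
    origin only. *)
Lemma piece_agree b b' u v : region_form b u v <= 0 -> region_form b' u v <= 0 ->
  piece b u v = piece b' u v /\
  forall du dv, piece_slope b u v du dv = piece_slope b' u v du dv.
Proof.
have sqr_eq0 (x : R) : x ^+ 2 <= 0 -> x = 0.
  by move=> H; apply/eqP; rewrite -sqrf_eq0 eq_le H sqr_ge0.
have slope_mul0 a : penalty_slope (a * 0) = 0 by rewrite mulr0 penalty_slope0.
case: b b' => [s c] [s' c'].
have [<-|] := eqVneq s s'.
  have [<-//|cc'] := eqVneq c c'; rewrite /region_form/= => h h'.
  have y0 : (if s then u else v) = 0.
    by apply: sqr_eq0; case: c c' cc' h h' => [] []//; nra.
  rewrite /piece /piece_slope/= y0 !penalty_quad_at0// !slope_mul0.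
  by split=> [|du dv]; case: c c' {cc' h h'} => [] []; ring.
wlog -> : s s' c c' / s = false.
  move=> H ss' h h'; case: s s' ss' h h' => [] [] // _ h h'; last exact: H.
  by have [-> S] := H false true c' c erefl isT h' h; split=> [|du dv];
      rewrite ?S.
case: s' => // _; have [<-|cc'] := eqVneq c c'; rewrite /region_form/= => h h'.
  case: c h h' => h h'.
    have uv : u = v by apply/eqP; rewrite -subr_eq0; apply/eqP/sqr_eq0; nra.
    split=> [|du dv]; first by rewrite /piece/= uv.
    rewrite /piece_slope/= uv /a1.
    have -> : alpha * (v + r * v) = alpha * (1 + r) * v by ring.
    ring.
  have uv : v = - u by apply/eqP; rewrite -subr_eq0; apply/eqP/sqr_eq0; nra.
  rewrite /piece /piece_slope/= uv !mulrN.
  rewrite (_ : - u + r * u = - (u - r * u)); last by ring.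
  rewrite !mulrN !penalty_slopeN !penalty_quadN//.
  split=> // du dv; rewrite /a2.
  have -> : alpha * (u - r * u) = alpha * (1 - r) * u by ring.
  ring.
have u0 : u = 0 by apply: sqr_eq0; case: c c' cc' h h' => [] []//; nra.
have v0 : v = 0 by apply: sqr_eq0; case: c c' cc' h h' => [] []//; nra.
rewrite /piece /piece_slope/= u0 v0.
rewrite !(mulr0, addr0, penalty_slope0) !penalty_quad_at0//.
by split=> [|du dv]; case: c c' {cc' h h'} => [] []; ring.
Qed.

Lemma region_cover u v : exists b, region_form b u v <= 0.
Proof.
have [h|h1] := leP (region_form (false, true) u v) 0.
  by exists (false, true).
have [h|h2] := leP (region_form (true, true) u v) 0.
  by exists (true, true).
have [h|h3] := leP (region_form (true, false) u v) 0.
  by exists (true, false).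
exists (false, false); move: h1 h2 h3; rewrite /region_form/=; nra.
Qed.

Let alphaE : (a1 + a2) / 2 = alpha.
Proof. by rewrite /a1 /a2; field. Qed.

Let rE : (a1 - a2) / (a1 + a2) = r.
Proof.
have -> : a1 + a2 = 2 * alpha by rewrite /a1 /a2; ring.
by rewrite /a1 /a2; field; rewrite gt_eqF.
Qed.

Definition bivariate_quad (b1 b2 u v : R) : R :=
  bivariate_S phi b1 b2 u v + pair_form _ b1 b2 u v.

(** The quadratic terms add up since [alpha / 2 * (x + r * y) ^ 2 +
    (1 - r) * (a1 / 2) * y ^ 2 = pair_form a1 a2 x y], and likewise with
    [(1 + r) * (a2 / 2)]. *)
Lemma bivariate_quad_piece b u v : region_form b u v <= 0 ->
  bivariate_quad a1 a2 u v = piece b u v.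
Proof.
move=> hb.
suff [b' hb' ->] : exists2 b', region_form b' u v <= 0 &
    bivariate_quad a1 a2 u v = piece b' u v.
  by have [-> _] := piece_agree _ _ _ _ hb' hb.
have nz : (a1 == 0) && (a2 == 0) = false.
  apply/negP => /andP[/eqP a10 /eqP a20]; move: alphaE alpha_gt0.
  by rewrite a10 a20 addr0 mul0r => <-; rewrite ltxx.
rewrite /bivariate_quad /pair_form /bivariate_S nz alphaE rE.
case: ifPn => [h|h1].
  exists (false, true); first by rewrite /region_form/=; lra.
  by rewrite /piece/= /penalty_quad /a1 /a2; field.
case: ifPn => [h|h2].
  exists (true, true); first by rewrite /region_form/=; lra.
  by rewrite /piece/= /penalty_quad /a1 /a2 (addrC v); field.
case: ifPn => [h|h3].
  exists (true, false); first by rewrite /region_form/=; lra.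
  by rewrite /piece/= /penalty_quad /a1 /a2 (addrC v); field.
exists (false, false); last by rewrite /piece/= /penalty_quad /a1 /a2; field.
by rewrite /region_form/=; move: h1 h2 h3; rewrite -!ltNge; nra.
Qed.

Let continuous_line (a b : R) : continuous (fun x : R => a + x * b).
Proof.
by move=> x; apply: cvgD; [exact: cvg_cst|apply: cvgM;
    [exact: cvg_id|exact: cvg_cst]].
Qed.

Lemma le_chord_bivariate_quad_pieces u0 v0 u1 v1 t : 0 <= t <= 1 ->
  bivariate_quad a1 a2 (u0 + t * (u1 - u0)) (v0 + t * (v1 - v0)) <=
  t * bivariate_quad a1 a2 u1 v1 + (1 - t) * bivariate_quad a1 a2 u0 v0.
Proof.
pose U x := u0 + x * (u1 - u0); pose V x := v0 + x * (v1 - v0).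
have -> : bivariate_quad a1 a2 u1 v1 = bivariate_quad a1 a2 (U 1) (V 1).
  by rewrite /U /V !mul1r !subrKC.
have -> : bivariate_quad a1 a2 u0 v0 = bivariate_quad a1 a2 (U 0) (V 0).
  by rewrite /U /V !mul0r !addr0.
have cU : continuous U by exact: continuous_line.
have cV : continuous V by exact: continuous_line.
apply: (@le_chord_piecewise _ _ (fun x => bivariate_quad a1 a2 (U x) (V x))
  (fun b x => region_form b (U x) (V x)) (fun b x => piece b (U x) (V x))
  (fun b x => piece_slope b (U x) (V x) (u1 - u0) (v1 - v0))).
- move=> [[] []] x; rewrite /region_form /=;
    (apply: cvgM; [|first [apply: cvgB|apply: cvgD]]); (exact: cU || exact: cV).
- move=> b x.
  have cq a (f : R -> R) : 0 <= a -> continuous f ->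
      continuous (penalty_quad a \o f).
    by move=> a0 cf y; apply: continuous_comp;
        [exact: cf|exact: continuous_penalty_quad].
  have cy : continuous (if b.1 then U else V) by case: b.1.
  have cxy : continuous (fun x =>
      (if b.1 then V x else U x) + r * (if b.1 then U x else V x)).
    move=> y; apply: cvgD; first by case: b.1; [exact: cV|exact: cU].
    by apply: cvgM; [exact: cvg_cst|case: b.1; [exact: cU|exact: cV]].
  apply: cvgD; first exact: (cq alpha _ alpha_ge0 cxy x).
  case: b cy {cxy} => [b1 []] /= cy; apply: cvgM; try exact: cvg_cst.
    by case: b1 cy => cy; exact: (cq a1 _ a1_ge0 cy x).
  by case: b1 cy => cy; exact: (cq a2 _ a2_ge0 cy x).
- by move=> x; apply: region_cover.
- by move=> b x; apply: bivariate_quad_piece.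
- by move=> b b' x hb hb'; have [_ ->] := piece_agree _ _ _ _ hb hb'.
- move=> b c x; apply: le_trans (piece_support b (U c) (V c) (U x) (V x)).
  rewrite lerD2l le_eqVlt; apply/orP; left; apply/eqP.
  by rewrite /piece_slope /U /V; case: b => [[] []] /=; ring.
Qed.

End Pieces.

(** If [a1 + a2 = 0], then both parameters and the function vanish. *)
Lemma le_chord_bivariate_quad a1 a2 u0 v0 u1 v1 t :
  0 <= a1 -> 0 <= a2 -> 0 <= t <= 1 ->
  bivariate_quad a1 a2 (u0 + t * (u1 - u0)) (v0 + t * (v1 - v0)) <=
  t * bivariate_quad a1 a2 u1 v1 + (1 - t) * bivariate_quad a1 a2 u0 v0.
Proof.
move=> a10 a20 t01.
have [a120|a120] := eqVneq (a1 + a2) 0.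
  have -> : a1 = 0 by lra.
  have -> : a2 = 0 by lra.
  rewrite /bivariate_quad /pair_form /bivariate_S eqxx/=.
  by rewrite !mul0r !addr0 !mulr0 addr0.
pose alpha := (a1 + a2) / 2; pose r := (a1 - a2) / (a1 + a2).
have s0 : 0 < a1 + a2 by rewrite lt_neqAle eq_sym a120 addr_ge0.
have E1 : a1 = alpha * (1 + r) by rewrite /alpha /r; field.
have E2 : a2 = alpha * (1 - r) by rewrite /alpha /r; field.
rewrite E1 E2; apply: le_chord_bivariate_quad_pieces => //.
- by rewrite /alpha divr_gt0.
- have -> : 1 + r = 2 * a1 / (a1 + a2) by rewrite /r; field.
  by rewrite divr_ge0 ?mulr_ge0// ltW.
- have -> : 1 - r = 2 * a2 / (a1 + a2) by rewrite /r; field.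
  by rewrite divr_ge0 ?mulr_ge0// ltW.
Qed.

End ConvexifiedPenalty.

(** * Parseval's identity for polynomials at roots of unity *)

Section DiscreteParseval.
Local Open Scope complex_scope.
Context {R : realType}.
Implicit Types (p q : {poly R}) (x y w : R).

Lemma expiD x y : expi (x + y) = expi x * expi y.
Proof.
by apply/eqP; rewrite eq_complex /= cosD sinD [_ + cos x * _]addrC !eqxx.
Qed.

Lemma expiN x : expi (- x) = (expi x)^*.
Proof. by rewrite /expi cosN sinN. Qed.

Lemma expi0 : expi (0 : R) = 1.
Proof. by rewrite /expi cos0 sin0. Qed.

Lemma expiX x n : expi x ^+ n = expi (x * n%:R).
Proof.
elim: n => [|n IHn]; first by rewrite expr0 mulr0 expi0.
by rewrite exprS IHn -expiD -natr1 mulrDr mulr1 addrC.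
Qed.

Lemma expi2pi n : expi (2 * pi * n%:R : R) = 1.
Proof. by rewrite -expiX /expi mulrC mulr_natr cos2pi sin2pi expr1n. Qed.

(** By the half-angle formula [1 - cos x = 2 * sin (x / 2) ^ 2]. *)
Lemma expi_neq1 x : 0 < x < 2 * pi -> expi x != 1.
Proof.
move=> /andP[x0 x2pi]; apply/eqP => /(congr1 (@complex.Re R)) /= cosx.
have : 0 < sin (x / 2) by apply: sin_gt0_pi; lra.
have := cos2Dsin2 (x / 2).
have : cos (x / 2 + x / 2) = 1 by rewrite -splitr.
rewrite cosD; nra.
Qed.

(** A geometric sum whose ratio is an [M]-th root of unity different from 1. *)
Lemma sum_expi_root (M i j : nat) : (i < M)%N -> (j < M)%N -> i != j ->
  \sum_(k < M) expi (2 * pi / M%:R * (i%:R - j%:R) : R) ^+ k = 0.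
Proof.
move=> iM jM ij.
have M0 : 0 < M%:R :> R by rewrite ltr0n (leq_ltn_trans _ iM).
pose x : R := 2 * pi / M%:R * (i%:R - j%:R).
have xM1 : expi x ^+ M = 1.
  rewrite expiX /x mulrAC divfK ?gt_eqF// mulrBr expiD expiN !expi2pi.
  by rewrite conjc1 mulr1.
suff x1 : expi x - 1 != 0 by apply: (mulfI x1); rewrite -subrX1 xM1 subrr mulr0.
have small (a b : nat) : (a < M)%N -> (b < a)%N ->
    expi (2 * pi / M%:R * (a%:R - b%:R) : R) != 1.
  move=> aM ba; apply: expi_neq1; have p0 := pi_gt0 R.
  rewrite mulr_gt0 ?divr_gt0 ?mulr_gt0 ?subr_gt0 ?ltr_nat//=.
  rewrite mulrAC ltr_pdivrMr// ltr_pM2l ?mulr_gt0//.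
  by rewrite ltrBlDr -natrD ltr_nat ltn_addr.
rewrite subr_eq0 /x; case: (ltngtP i j) ij => // [ij|ji] _; last exact: small.
rewrite -opprB mulrN expiN; apply: contra (small j i jM ij) => /eqP e.
by rewrite -[expi _]conjcK e conjc1.
Qed.

Lemma sqr_normcE (z : R[i]) : (Normc.normc z ^+ 2)%:C = z * z^*.
Proof.
case: z => a b; rewrite /Normc.normc sqr_sqrtr ?addr_ge0 ?sqr_ge0//.
by apply/eqP; rewrite eq_complex /=; apply/andP; split; apply/eqP; ring.
Qed.

(** The frequency response of the finite causal filter with the coefficients of
    [p]; convolution of filters is multiplication of polynomials. *)
Definition poly_response p w : R[i] := (map_poly (real_complex R) p).[expi (- w)].

Lemma poly_responseM p q w :
  poly_response (p * q) w = poly_response p w * poly_response q w.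
Proof. by rewrite /poly_response rmorphM hornerM. Qed.

Lemma poly_responseE p n w : (size p <= n)%N ->
  poly_response p w = \sum_(i < n) (p`_i)%:C * expi (- (w * i%:R)).
Proof.
move=> pn; rewrite /poly_response (@horner_coef_wide _ n); last first.
  by rewrite size_map_poly.
by apply: eq_bigr => i _; rewrite coef_map expiX mulNr.
Qed.

(** Expanding the squared modulus gives, for each pair of coefficients [i], [j],
    the sum over [k] of the [k]-th powers of a root of unity, which vanishes
    unless [i = j]. The hypothesis [size p <= M] excludes aliasing: no two
    exponents in [p] are congruent modulo [M]. *)
Lemma discrete_parseval p (M : nat) : (size p <= M)%N ->
  \sum_(k < M) Normc.normc (poly_response p (2 * pi / M%:R * k%:R)) ^+ 2 =
  M%:R * \sum_(i < M) p`_i ^+ 2.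
Proof.
move=> pM; apply: (@complexI R).
rewrite rmorph_sum rmorphM rmorph_nat rmorph_sum /=.
transitivity (\sum_(k < M) \sum_(i < M) \sum_(j < M)
    (p`_i * p`_j)%:C * expi (2 * pi / M%:R * (j%:R - i%:R)) ^+ k).
  apply: eq_bigr => k _.
  rewrite sqr_normcE (poly_responseE _ _ _ pM) rmorph_sum mulr_suml.
  apply: eq_bigr => i _; rewrite mulr_sumr; apply: eq_bigr => j _.
  set w := 2 * pi / _ * _.
  transitivity ((p`_i)%:C * expi (- (w * i%:R)) * ((p`_j)%:C * expi (w * j%:R))).
    by congr (_ * _); apply/eqP; rewrite eq_complex /= cosN sinN; apply/andP;
      split; apply/eqP; ring.
  rewrite mulrACA -expiD expiX -rmorphM.
  by congr (_ * expi _); rewrite /w; ring.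
rewrite exchange_big mulr_sumr; apply: eq_bigr => i _ /=.
rewrite exchange_big (bigD1 i)//= [X in _ + X]big1 => [|j ji].
  rewrite addr0 (eq_bigr (fun=> (p`_i ^+ 2)%:C)) => [|k _]; last first.
    by rewrite subrr mulr0 expi0 expr1n mulr1 expr2.
  by rewrite sumr_const card_ord mulr_natl.
by rewrite -mulr_sumr sum_expi_root ?mulr0.
Qed.

End DiscreteParseval.

(** * Sums over the integers and their finite windows *)

Section IntegerSums.
Context {R : realType}.
Implicit Types (f g u h : int -> R) (L M : nat).

Definition outside L f (n : int) : R := if (absz n <= L)%N then 0 else f n.

Definition isum f : \bar R := \esum_(n in [set: int]) (f n)%:E.

Lemma isum_ge0 f : (forall n, 0 <= f n) -> (0 <= isum f)%E.
Proof. by move=> f0; apply: esum_ge0 => n _; rewrite lee_fin. Qed.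

Lemma le_isum f g : (forall n, f n <= g n) -> (isum f <= isum g)%E.
Proof. by move=> fg; apply: le_esum => n _; rewrite lee_fin. Qed.

Lemma isumD f g : (forall n, 0 <= f n) -> (forall n, 0 <= g n) ->
  isum (fun n => f n + g n) = (isum f + isum g)%E.
Proof. by move=> f0 g0; rewrite -esumD// => n _; rewrite lee_fin. Qed.

Lemma isum_image f M (e : 'I_M -> int) : injective e -> (forall n, 0 <= f n) ->
  \esum_(n in range e) (f n)%:E = (\sum_(i < M) f (e i))%:E.
Proof.
move=> e_inj f0; rewrite esum_image; last by move=> i j _ _; exact: e_inj.
have -> : [set: 'I_M] = [set` index_enum 'I_M].
  by apply/seteqP; split=> i //= _; exact: mem_index_enum.
rewrite esum_fset//; last by move=> i _; rewrite lee_fin.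
by rewrite -fsbig_seq ?index_enum_uniq// sumEFin.
Qed.

Lemma sum_le_isum f M (e : 'I_M -> int) : injective e -> (forall n, 0 <= f n) ->
  ((\sum_(i < M) f (e i))%:E <= isum f)%E.
Proof.
move=> e_inj f0; rewrite -isum_image// /isum esum_mkcond; apply: le_esum => n _.
by case: ifP; rewrite // lee_fin.
Qed.

Lemma esum_ball f L : (forall n, 0 <= f n) ->
  \esum_(n in [set n : int | (absz n <= L)%N]) (f n)%:E =
  (\sum_(i < (2 * L).+1) f (i%:Z - L%:Z))%:E.
Proof.
move=> f0; pose e (i : 'I_(2 * L).+1) : int := i%:Z - L%:Z.
have e_inj : injective e by move=> i j /addIr [] /val_inj.
rewrite -(isum_image f _ e)//; congr esum; apply/seteqP; split=> n /=.
  move=> nL; have iL : (absz (n + L%:Z)%R < (2 * L).+1)%N by lia.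
  by exists (Ordinal iL) => //; rewrite /e/=; lia.
by move=> [i _ <-]; have := ltn_ord i; rewrite /e; lia.
Qed.

Lemma isum_window f L : (forall n, 0 <= f n) ->
  isum f = ((\sum_(i < (2 * L).+1) f (i%:Z - L%:Z))%:E + isum (outside L f))%E.
Proof.
move=> f0; rewrite -esum_ball// esum_mkcond /isum -esumD; last 2 first.
- by move=> n _; case: ifP; rewrite // lee_fin.
- by move=> n _; rewrite /outside; case: ifP; rewrite // lee_fin.
apply: eq_esum => n _; rewrite /outside.
rewrite (_ : (n \in _) = (absz n <= L)%N); last first.
  by apply/idP/idP => [/set_mem|nL]; [|exact: mem_set].
by case: ifP; rewrite ?adde0 ?add0e.
Qed.

(** A finite set of integers carries the sum up to [eps], and it lies in some
    window. *)
Lemma isum_tail h (eps : R) : (isum (fun n => `|h n|%R) < +oo)%E -> 0 < eps ->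
  exists L, (isum (outside L (fun n => `|h n|%R)) <= eps%:E)%E.
Proof.
move=> hfin eps0.
have h0 n : 0 <= `|h n| by [].
have hfn : isum (fun n => `|h n|) \is a fin_num.
  by rewrite ge0_fin_numE// isum_ge0.
have [_ [X [Xfin _] <-] lt_X] := ub_ereal_sup_adherent eps0 hfn.
exists (\max_(n <- fset_set X) absz n)%N; set L := (\max_(n <- _) _)%N.
have XL n : X n -> (absz n <= L)%N.
  by move=> Xn; rewrite /L; apply: leq_bigmax_seq => //;
      rewrite in_fset_set// mem_set.
have := isum_window _ L h0; rewrite -(esum_ball (fun n => `|h n|))//.
set s := (\esum_(_ in [set _ | _]) _) => isumE.
have Xs : (\sum_(i \in X) (`|h i|)%:E <= s)%E.
  by apply: ereal_sup_ubound; exists X => //; split=> //; exact: XL.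
have s_fin : s \is a fin_num by rewrite /s esum_ball.
have := lt_le_trans lt_X Xs.
rewrite -[ereal_sup _]/(isum (fun n => `|h n|)) lteBlDr// isumE => lt_s.
have : (s + isum (outside L (fun n => `|h n|%R)) <= s + eps%:E)%E.
  exact: ltW.
by rewrite leeD2lE.
Qed.

(** The windows are cofinal among the finite sets of integers. *)
Lemma isum_le f (K : R) : (forall n, 0 <= f n) ->
  (forall L, \sum_(i < (2 * L).+1) f (i%:Z - L%:Z) <= K) -> (isum f <= K%:E)%E.
Proof.
move=> f0 fK; apply: ge_ereal_sup => _ [X [Xfin _] <-].
pose L := (\max_(n <- fset_set X) absz n)%N.
apply: (@le_trans _ _ (\sum_(i < (2 * L).+1) f (i%:Z - L%:Z))%:E).
  2: by rewrite lee_fin.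
rewrite -esum_ball//; apply: ereal_sup_ubound; exists X => //; split=> // n Xn /=.
by rewrite /L; apply: leq_bigmax_seq => //; rewrite in_fset_set// mem_set.
Qed.

Lemma isum_fin f : (forall n, 0 <= f n) -> (isum f < +oo)%E ->
  isum f = (fine (isum f))%:E.
Proof. by move=> f0 foo; rewrite fineK// ge0_fin_numE// isum_ge0. Qed.

Lemma sum_le_fine_isum f M (e : 'I_M -> int) :
  injective e -> (forall n, 0 <= f n) -> (isum f < +oo)%E ->
  \sum_(i < M) f (e i) <= fine (isum f).
Proof. by move=> e_inj f0 foo; rewrite -lee_fin -isum_fin// sum_le_isum. Qed.

Lemma isumZ (c : R) f : 0 <= c -> (forall n, 0 <= f n) -> (isum f < +oo)%E ->
  isum (fun n => c * f n) = (c * fine (isum f))%:E.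
Proof.
have le (d : R) g : 0 <= d -> (forall n, 0 <= g n) -> (isum g < +oo)%E ->
    (isum (fun n => (d * g n)%R) <= (d * fine (isum g))%:E)%E.
  move=> d0 g0 goo; apply: isum_le => [n|L]; first exact: mulr_ge0.
  rewrite -mulr_sumr ler_wpM2l// (sum_le_fine_isum g _ (fun i => i%:Z - L%:Z))//.
  by move=> i j /addIr [] /val_inj.
move=> c0 f0 foo; apply/eqP; rewrite eq_le le//=.
have [->|cn0] := eqVneq c 0.
  by rewrite mul0r isum_ge0// => n; rewrite mul0r.
have cf0 n : 0 <= c * f n by exact: mulr_ge0.
have cfoo : (isum (fun n => (c * f n)%R) < +oo)%E.
  by rewrite (le_lt_trans (le _ _ c0 f0 foo))// ltry.
have cV0 : 0 <= c^-1 by rewrite invr_ge0.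
have := le c^-1 _ cV0 cf0 cfoo.
rewrite (_ : (fun n => c^-1 * (c * f n)) = f); last first.
  by apply/funext => n; rewrite mulKf.
rewrite [X in (X <= _)%E](isum_fin _ f0 foo) lee_fin => h.
rewrite [leRHS](isum_fin _ cf0 cfoo) lee_fin.
by rewrite -ler_pdivlMl// lt_neqAle eq_sym cn0.
Qed.

Lemma isum_fin_le f g : (forall n, f n <= g n) -> (isum g < +oo)%E ->
  (isum f < +oo)%E.
Proof. by move=> fg; apply: le_lt_trans; exact: le_isum. Qed.

(** A common window for all the nonnegative families below [|h|]: this is what
    makes the cut-off of the frequency response uniform in the frequency. *)
Lemma fine_isum_window h g L (eps : R) :
  (forall n, 0 <= g n) -> (forall n, g n <= `|h n|) ->
  (isum (fun n => `|h n|%R) < +oo)%E ->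
  (isum (outside L (fun n => `|h n|%R)) <= eps%:E)%E ->
  \sum_(i < (2 * L).+1) g (i%:Z - L%:Z) <= fine (isum g) <=
  \sum_(i < (2 * L).+1) g (i%:Z - L%:Z) + eps.
Proof.
move=> g0 gh hoo tail.
have goo : (isum g < +oo)%E by exact: isum_fin_le hoo.
rewrite -!lee_fin -isum_fin// (isum_window _ L)// EFinD; apply/andP; split.
  by rewrite leeDl// isum_ge0// => n; rewrite /outside; case: ifP.
rewrite leeD2l// (le_trans _ tail)// le_isum// => n.
by rewrite /outside; case: ifP.
Qed.

Lemma sumZE u : sumZ u =
  fine (isum (fun n => Num.max (u n) 0)) -
  fine (isum (fun n => Num.max (- u n) 0)).
Proof.
rewrite /sumZ /isum; congr (fine _ - fine _); apply: eq_esum => n _.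
  by rewrite funeposE /= -EFin_max.
by rewrite funenegE -EFin_max.
Qed.

Lemma sumZ_window h u L (eps : R) : (forall n, `|u n| <= `|h n|) ->
  (isum (fun n => `|h n|%R) < +oo)%E ->
  (isum (outside L (fun n => `|h n|%R)) <= eps%:E)%E ->
  `|sumZ u - \sum_(i < (2 * L).+1) u (i%:Z - L%:Z)| <= eps.
Proof.
move=> uh hoo tail.
have uE n : u n = Num.max (u n) 0 - Num.max (- u n) 0.
  by case: (leP (u n) 0) => u0; case: (leP (- u n) 0) => ?; lra.
have max0 (x : R) : 0 <= Num.max x 0 by rewrite le_max lexx orbT.
have posh n : Num.max (u n) 0 <= `|h n|.
  by rewrite ge_max normr_ge0 andbT (le_trans (ler_norm _)).
have negh n : Num.max (- u n) 0 <= `|h n|.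
  by rewrite ge_max normr_ge0 andbT (le_trans (ler_norm _))// normrN.
have /andP[] := fine_isum_window h _ L eps (fun n => max0 (u n)) posh hoo tail.
have /andP[] := fine_isum_window h _ L eps (fun n => max0 (- u n)) negh hoo tail.
have -> : \sum_(i < (2 * L).+1) u (i%:Z - L%:Z) =
    \sum_(i < (2 * L).+1) Num.max (u (i%:Z - L%:Z)) 0 -
    \sum_(i < (2 * L).+1) Num.max (- u (i%:Z - L%:Z)) 0.
  by rewrite -sumrB; apply: eq_bigr => i _; exact: uE.
rewrite sumZE ler_norml; lra.
Qed.

Lemma norm_sumZ_le h u : (forall n, `|u n| <= `|h n|) ->
  (isum (fun n => `|h n|%R) < +oo)%E ->
  `|sumZ u| <= fine (isum (fun n => `|h n|)).
Proof.
move=> uh hoo; set C := fine _.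
have bound (v : int -> R) : (forall n, v n <= `|h n|) ->
    0 <= fine (isum (fun n => Num.max (v n) 0)) <= C.
  move=> vh; have max0 (x : R) : 0 <= Num.max x 0 by rewrite le_max lexx orbT.
  have vh' n : Num.max (v n) 0 <= `|h n| by rewrite ge_max normr_ge0 andbT.
  rewrite fine_ge0 ?isum_ge0//= -lee_fin -!isum_fin ?le_isum//.
  exact: isum_fin_le hoo.
have /andP[] := bound u (fun n => le_trans (ler_norm _) (uh n)).
have uNh n : - u n <= `|h n| by rewrite (le_trans (ler_norm _))// normrN.
have /andP[] := bound (fun n => - u n) uNh.
by rewrite sumZE ler_norml; lra.
Qed.

End IntegerSums.

(** * Cutting off the filter *)

Section WindowedResponse.
Local Open Scope complex_scope.
Context {R : realType}.
Implicit Types (p q : {poly R}) (w : R) (h : int -> R).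

(** The filter [h] restricted to the window [- L <= n <= L], shifted by [L]
    in order to become causal. The shift multiplies the response by a phase
    factor, so its modulus is not affected. *)
Definition window_poly h L : {poly R} := \poly_(i < (2 * L).+1) h (i%:Z - L%:Z).

Lemma sqr_normc_Re_Im (z : R[i]) :
  Normc.normc z ^+ 2 = complex.Re z ^+ 2 + complex.Im z ^+ 2.
Proof. by case: z => a b /=; rewrite sqr_sqrtr// addr_ge0 ?sqr_ge0. Qed.

Lemma sqr_normc_expi (x : R) (z : R[i]) :
  Normc.normc (expi x * z) ^+ 2 = Normc.normc z ^+ 2.
Proof.
rewrite Normc.normcM exprMn [X in X * _]sqr_normc_Re_Im /=.
by rewrite cos2Dsin2 mul1r.
Qed.

Lemma sqr_le_of_near (a b C eps : R) :
  `|a| <= C -> `|b| <= C -> `|a - b| <= eps ->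
  a ^+ 2 <= b ^+ 2 + 2 * C * eps.
Proof.
move=> aC bC ab.
have : `|(a - b) * (a + b)| <= eps * (C + C).
  by rewrite normrM ler_pM// (le_trans (ler_normD _ _))// lerD.
by move=> /(le_trans (ler_norm _)); lra.
Qed.

(** The squared modulus is the sum of the squares of the real and imaginary
    parts. Both parts are bounded by the l1 norm of [h] and change by at most
    [eps], so each square changes by at most [2 * eps] times that norm. *)
Lemma freq_response_window h L (eps w : R) :
  (isum (fun n => `|h n|%R) < +oo)%E ->
  (isum (outside L (fun n => `|h n|%R)) <= eps%:E)%E ->
  Normc.normc (freq_response h w) ^+ 2 <=
  Normc.normc (poly_response (window_poly h L) w) ^+ 2 +
  4 * fine (isum (fun n => `|h n|)) * eps.
Proof.
move=> hoo tail; set C := fine _.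
have sumC M (e : 'I_M -> int) : injective e -> \sum_(i < M) `|h (e i)| <= C.
  by move=> e_inj; exact: sum_le_fine_isum.
have e_inj : injective (fun i : 'I_(2 * L).+1 => i%:Z - L%:Z).
  by move=> i j /addIr [] /val_inj.
have part (g : R -> R) : (forall x, `|g x| <= 1) ->
    sumZ (fun n => h n * g (- (w * n%:~R))) ^+ 2 <=
    (\sum_(i < (2 * L).+1) h (i%:Z - L%:Z) * g (- (w * (i%:Z - L%:Z)%:~R))) ^+ 2 +
    2 * C * eps.
  move=> g1; have uh n : `|h n * g (- (w * n%:~R))| <= `|h n|.
    by rewrite normrM ler_piMr.
  apply: sqr_le_of_near.
  - exact: norm_sumZ_le.
  - apply: le_trans (ler_norm_sum _ _ _) _; apply: le_trans (sumC _ _ e_inj).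
    by apply: ler_sum => i _; exact: uh.
  - by have := sumZ_window h _ L eps uh hoo tail.
rewrite -(sqr_normc_expi (w * L%:R) (poly_response _ _)).
have -> : expi (w * L%:R) * poly_response (window_poly h L) w =
    (\sum_(i < (2 * L).+1) h (i%:Z - L%:Z) * cos (- (w * (i%:Z - L%:Z)%:~R))) +i*
    (\sum_(i < (2 * L).+1) h (i%:Z - L%:Z) * sin (- (w * (i%:Z - L%:Z)%:~R))).
  rewrite (poly_responseE _ _ _ (size_poly _ _)) mulr_sumr.
  transitivity (\sum_(i < (2 * L).+1)
     ((h (i%:Z - L%:Z) * cos (- (w * (i%:Z - L%:Z)%:~R))) +i*
      (h (i%:Z - L%:Z) * sin (- (w * (i%:Z - L%:Z)%:~R))))).
    apply: eq_bigr => i _; rewrite coef_poly ltn_ord mulrCA -expiD.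
    have -> : w * L%:R - w * i%:R = - (w * (i%:Z - L%:Z)%:~R).
      by rewrite intrB -!pmulrn; ring.
    by apply/eqP; rewrite eq_complex /=; apply/andP; split; apply/eqP; ring.
  by elim/big_ind3 : _ => //= x1 x2 x3 y1 y2 y3 -> ->; apply/eqP;
      rewrite eq_complex /= !eqxx.
have -> : freq_response h w =
    sumZ (fun n => h n * cos (- (w * n%:~R))) +i*
    sumZ (fun n => h n * sin (- (w * n%:~R))).
  by rewrite /freq_response /csumZ; congr (sumZ _ +i* sumZ _);
      apply/funext => n /=; ring.
rewrite !sqr_normc_Re_Im /=.
have := part cos; have := part sin.
have cos1 x : `|cos x| <= 1 :> R by rewrite ler_norml cos_geN1 cos_le1.
have sin1 x : `|sin x| <= 1 :> R by rewrite ler_norml sin_geN1 sin_le1.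
move=> /(_ sin1) ? /(_ cos1) ?; lra.
Qed.

(** Both sides are means over [M]-th roots of unity [z], by Parseval, and the
    inequality holds at each of them: [|1 + z|^2 = 2 + 2 * cos w] and
    [|1 - z|^2 = 2 - 2 * cos w], while the response of [p * q] is the product of
    those of [p] and [q]. *)
Lemma poly_energy_ge p q (A B d : R) (M : nat) : (0 < M)%N ->
  (size (p * q)%R <= M)%N -> (size q < M)%N ->
  (forall w, A * ((1 + cos w) / 2) + B * ((1 - cos w) / 2) <=
    Normc.normc (poly_response p w) ^+ 2 + d) ->
  \sum_(i < M) (A / 4 * ((1 + 'X) * q)`_i ^+ 2 +
                B / 4 * ((1 - 'X) * q)`_i ^+ 2) <=
  \sum_(i < M) (p * q)`_i ^+ 2 + d * \sum_(i < M) q`_i ^+ 2.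
Proof.
move=> M0 spq sq ge.
have sX (c : R) : (size ((1 + c *: 'X) * q)%R <= M)%N.
  apply: leq_trans (size_polyMleq _ _) _.
  have : (size (1 + c *: 'X : {poly R})%R <= 2)%N.
    apply: leq_trans (size_polyD _ _) _; rewrite geq_max size_poly1/=.
    by apply: leq_trans (size_scale_leq _ _) _; rewrite size_polyX.
  by lia.
have MR : 0 < M%:R :> R by rewrite ltr0n.
rewrite big_split/= -!mulr_sumr -(ler_pM2l MR) !mulrDr !(mulrCA M%:R).
have sX1 := sX 1; have sXN := sX (-1).
rewrite scale1r in sX1; rewrite scaleN1r in sXN.
rewrite -!discrete_parseval//; last exact: ltnW.
rewrite !mulr_sumr -!big_split/=; apply: ler_sum => k _.
set w := 2 * pi / _ * _; rewrite !poly_responseM !Normc.normcM !exprMn.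
have linE (c : R) : Normc.normc (poly_response (1 + c *: 'X) w) ^+ 2 =
    1 + 2 * c * cos w + c ^+ 2.
  rewrite /poly_response rmorphD rmorph1 /= map_polyZ map_polyX.
  rewrite hornerD hornerC hornerZ hornerX sqr_normc_Re_Im /= cosN sinN.
  transitivity (1 + 2 * c * cos w + c ^+ 2 * (cos w ^+ 2 + sin w ^+ 2)).
    by ring.
  by rewrite cos2Dsin2 mulr1.
have := linE 1; rewrite scale1r => ->; have := linE (-1); rewrite scaleN1r => ->.
set n := Normc.normc (poly_response q w) ^+ 2.
have n0 : 0 <= n by exact: sqr_ge0.
have := ler_wpM2r n0 (ge w); lra.
Qed.

End WindowedResponse.

(** * The energy of the convolution *)

Section ConvolutionEnergy.
Context {R : realType}.
Variables (h : int -> R) (N : nat).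
Hypothesis h_fin : (isum (fun n => `|h n|%R) < +oo)%E.
Implicit Type x : 'rV[R]_N.

Let C := fine (isum (fun n => `|h n|)).
Let norm1 x := \sum_(k < N) `|x ord0 k|.

Let C_ge0 : 0 <= C. Proof. by apply: fine_ge0; exact: isum_ge0. Qed.
Let norm1_ge0 x : 0 <= norm1 x. Proof. exact: sumr_ge0. Qed.

Let h_le n : `|h n| <= C.
Proof.
have := sum_le_fine_isum (fun n => `|h n|) 1 (fun=> n).
by rewrite big_ord1; apply=> // i j _; rewrite !ord1.
Qed.

Lemma zero_padE x (k : 'I_N) : zero_pad x k.+1 = x ord0 k.
Proof. by rewrite /= valK. Qed.

Lemma zero_pad_out x k : (N <= k)%N -> zero_pad x k.+1 = 0.
Proof. by move=> Nk; rewrite /= insubN// -leqNgt. Qed.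

Lemma sum_shift_le (g : int -> R) x M (e : 'I_M -> int) : injective e ->
  (forall n, 0 <= g n) -> (isum g < +oo)%E ->
  \sum_(i < M) \sum_(k < N) g (e i - k.+1%:Z) * `|x ord0 k| <=
  fine (isum g) * norm1 x.
Proof.
move=> e_inj g0 goo; rewrite exchange_big mulr_sumr; apply: ler_sum => k _ /=.
rewrite -mulr_suml ler_wpM2r// (sum_le_fine_isum g _ (fun i => e i - k.+1%:Z))//.
by move=> i j /addIr /e_inj.
Qed.

Lemma norm_convolution_le x n : `|convolution h x n| <= C * norm1 x.
Proof.
rewrite /convolution mulr_sumr; apply: le_trans (ler_norm_sum _ _ _) _.
by apply: ler_sum => k _; rewrite normrM ler_wpM2r.
Qed.

(** The convolution is bounded and absolutely summable, both with the constant
    [C * norm1 x]. *)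
Lemma convolution_sq_fin x : (isum (fun n => (convolution h x n ^+ 2)%R) < +oo)%E.
Proof.
apply: (@le_lt_trans _ _ ((C * norm1 x) * (C * norm1 x))%:E); last exact: ltry.
apply: isum_le => [n|L]; first exact: sqr_ge0.
have e_inj : injective (fun i : 'I_(2 * L).+1 => i%:Z - L%:Z).
  by move=> i j /addIr [] /val_inj.
apply: le_trans (ler_wpM2l (mulr_ge0 C_ge0 (norm1_ge0 x))
  (sum_shift_le (fun n => `|h n|) x _ _ e_inj (fun=> normr_ge0 _) h_fin)).
rewrite mulr_sumr; apply: ler_sum => i _.
rewrite -real_normK ?num_real// expr2 ler_pM ?norm_convolution_le//.
apply: le_trans (ler_norm_sum _ _ _) _.
by apply: ler_sum => k _; rewrite normrM.
Qed.

Definition zero_pad_poly x : {poly R} := \poly_(k < N) zero_pad x k.+1.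

Lemma coef_zero_pad_poly x i : (zero_pad_poly x)`_i = zero_pad x i.+1.
Proof. by rewrite coef_poly; case: ltnP => // /zero_pad_out ->. Qed.

(** The convolution of [x] with the cut-off filter, read at [n = i + 1 - L]: the
    window accounts for the shift by [L], and the entry [x ord0 k] is the signal
    value at time [k + 1] for the shift by 1. *)
Lemma coef_window_zero_pad L x i :
  (window_poly h L * zero_pad_poly x)`_i =
  \sum_(k < N) (h (i.+1%:Z - L%:Z - k.+1%:Z) -
                outside L h (i.+1%:Z - L%:Z - k.+1%:Z)) * x ord0 k.
Proof.
pose G k := (h (i.+1%:Z - L%:Z - k.+1%:Z) -
             outside L h (i.+1%:Z - L%:Z - k.+1%:Z)) * zero_pad x k.+1.
under [RHS]eq_bigr do rewrite -zero_padE.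
rewrite coefMr.
rewrite (big_ord_widen (N + i.+1)
  (fun j => (window_poly h L)`_(i - j) * (zero_pad_poly x)`_j)) ?leq_addl//.
rewrite [RHS](big_ord_widen (N + i.+1) G) ?leq_addr//.
rewrite big_mkcond [RHS]big_mkcond; apply: eq_bigr => -[k kNi] _ /=.
rewrite coef_zero_pad_poly /G /outside coef_poly; case: (ltnP k N) => kN;
    last first.
  by rewrite zero_pad_out// mulr0; case: ifP.
have -> : i.+1%:Z - L%:Z - k.+1%:Z = i%:Z - k%:Z - L%:Z by lia.
case: (ltnP k i.+1) => ki.
  have -> : (i - k)%N%:Z = i%:Z - k%:Z by lia.
  have -> : (absz (i%:Z - k%:Z - L%:Z)%R <= L)%N = (i - k < (2 * L).+1)%N by lia.
  by case: ifP; rewrite ?subr0// subrr.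
have -> : (absz (i%:Z - k%:Z - L%:Z)%R <= L)%N = false by lia.
by rewrite subrr mul0r.
Qed.

(** Let [a] and [b] be the values of the two convolutions. As both are bounded by
    [C * norm1 x], we have [b ^ 2 <= a ^ 2 + 2 * C * norm1 x * |a - b|], and the
    [|a - b|] sum up to at most [eps * norm1 x]. *)
Lemma window_energy_le L (eps : R) x M :
  (isum (outside L (fun n => `|h n|%R)) <= eps%:E)%E ->
  \sum_(i < M) (window_poly h L * zero_pad_poly x)`_i ^+ 2 <=
  fine (isum (fun n => convolution h x n ^+ 2)) +
  2 * (C * norm1 x) * (eps * norm1 x).
Proof.
move=> tail; pose e (i : 'I_M) : int := i.+1%:Z - L%:Z.
have e_inj : injective e by move=> i j /addIr [] /val_inj.
pose a i := convolution h x (e i).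
pose b i := (window_poly h L * zero_pad_poly x)`_(i : 'I_M).
have out0 n : 0 <= outside L (fun n => `|h n|) n by rewrite /outside; case: ifP.
have out_fin : (isum (outside L (fun n => `|h n|%R)) < +oo)%E.
  by apply: le_lt_trans tail _; exact: ltry.
have diff i : `|a i - b i| <=
    \sum_(k < N) outside L (fun n => `|h n|) (e i - k.+1%:Z) * `|x ord0 k|.
  rewrite /a /b coef_window_zero_pad /convolution -sumrB.
  apply: le_trans (ler_norm_sum _ _ _) _; apply: ler_sum => k _.
  rewrite -mulrBl normrM ler_wpM2r// opprB addrC subrK /outside.
  by case: ifP; rewrite ?normr0.
have bC i : `|b i| <= C * norm1 x.
  rewrite /b coef_window_zero_pad mulr_sumr.
  apply: le_trans (ler_norm_sum _ _ _) _.
  apply: ler_sum => k _; rewrite normrM ler_wpM2r// /outside.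
  by case: ifP; rewrite ?subr0 ?subrr ?normr0.
apply: (@le_trans _ _
  (\sum_(i < M) (a i ^+ 2 + 2 * (C * norm1 x) * `|a i - b i|))).
  apply: ler_sum => i _.
  by apply: sqr_le_of_near; [exact: bC|exact: norm_convolution_le|rewrite distrC].
rewrite big_split/=; apply: lerD.
  apply: (sum_le_fine_isum (fun n => convolution h x n ^+ 2)) => // [n|];
      first exact: sqr_ge0.
  exact: convolution_sq_fin.
rewrite -mulr_sumr ler_wpM2l ?mulr_ge0//.
apply: (@le_trans _ _ (fine (isum (outside L (fun n => `|h n|))) * norm1 x)).
  by apply: le_trans (sum_shift_le _ x _ _ e_inj out0 out_fin);
      apply: ler_sum => i _; exact: diff.
by rewrite ler_wpM2r// -lee_fin -isum_fin.
Qed.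

(** With [z = expi (- w)], the bound on the response reads
    [A / 4 * |1 + z|^2 + B / 4 * |1 - z|^2 <= |H|^2], and multiplication by
    [1 + z] or [1 - z] turns the signal into the sums or differences of its
    neighbouring values. *)
Lemma convolution_energy_ge (A B : R) x :
  (forall w, A * ((1 + cos w) / 2) + B * ((1 - cos w) / 2) <=
    Normc.normc (freq_response h w) ^+ 2) ->
  \sum_(i < N.+1) pair_form _ A B (zero_pad x i) (zero_pad x i.+1) <=
  fine (isum (fun n => convolution h x n ^+ 2)).
Proof.
move=> ge; set Q := \sum_(i < _) _; set E := fine _.
(* The two cut-off errors add up to K * eps. *)
pose K := 2 * (C * norm1 x) * norm1 x + 4 * C * \sum_(i < N) x ord0 i ^+ 2.
have K0 : 0 <= K by rewrite addr_ge0// !mulr_ge0// sumr_ge0// => i _;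
    exact: sqr_ge0.
apply/ler_addgt0Pl => d d0; pose eps := d / (K + 1).
have eps0 : 0 < eps by rewrite divr_gt0// ltr_wpDl.
have [L tail] := isum_tail h eps h_fin eps0.
have Kd : K * eps <= d.
  by rewrite /eps mulrA ler_pdivrMr ?ltr_wpDl// mulrDr mulr1 mulrC lerDl ltW.
pose q := zero_pad_poly x; pose p := window_poly h L.
pose M := ((2 * L).+1 + N.+1)%N.
have sq : (size q <= N)%N by exact: size_poly.
have sp : (size p <= (2 * L).+1)%N by exact: size_poly.
have spq : (size (p * q)%R <= M)%N.
  by apply: leq_trans (size_polyMleq _ _) _; rewrite /M; lia.
have sqM : (size q < M)%N by rewrite /M; lia.
have geL w : A * ((1 + cos w) / 2) + B * ((1 - cos w) / 2) <=
    Normc.normc (poly_response p w) ^+ 2 + 4 * C * eps.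
  exact: le_trans (ge w) (freq_response_window _ _ _ _ h_fin tail).
have M0 : (0 < M)%N by [].
have := poly_energy_ge _ _ _ _ _ _ M0 spq sqM geL.
have -> : \sum_(i < M) q`_i ^+ 2 = \sum_(i < N) x ord0 i ^+ 2.
  have NM : (N <= M)%N by rewrite /M; lia.
  under [RHS]eq_bigr do rewrite -zero_padE.
  rewrite [RHS](big_ord_widen M (fun k => zero_pad x k.+1 ^+ 2))//
      [RHS]big_mkcond.
  apply: eq_bigr => i _; rewrite coef_zero_pad_poly; case: ltnP => // Ni.
  by rewrite zero_pad_out// expr0n.
have -> : \sum_(i < M) (A / 4 * ((1 + 'X) * q)`_i ^+ 2 +
                        B / 4 * ((1 - 'X) * q)`_i ^+ 2) = Q.
  have NM : (N.+1 <= M)%N by rewrite /M; lia.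
  rewrite /Q (big_ord_widen M
    (fun k => pair_form _ A B (zero_pad x k) (zero_pad x k.+1)))//.
  rewrite [RHS]big_mkcond; apply: eq_bigr => i _.
  rewrite mulrDl mulrBl !mul1r coefD coefB !coefXM !coef_zero_pad_poly.
  have -> : (if nat_of_ord i == 0%N then 0 else zero_pad x i.-1.+1) =
      zero_pad x i by case: (nat_of_ord i).
  rewrite /pair_form; case: ltnP => [_|Ni].
    by congr (_ * _ + _ * _); ring.
  case: (nat_of_ord i) Ni => // j Nj; rewrite !zero_pad_out ?(ltnW Nj)//.
  by rewrite addr0 subr0 expr0n/= !mulr0 addr0.
have := window_energy_le L eps x M tail; rewrite -/E -/p -/q.
move: Kd; rewrite /K; lra.
Qed.

End ConvolutionEnergy.

(** * Convexity of the objective *)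

Section Assembly.
Context {R : realType}.

(** How far the penalty of a pair may rise above its chords: the defect is that
    of the quadratic form whose addition makes it convex. *)
Lemma pair_penalty_chord (phi : R -> R -> R)
    (lambda a1 a2 A B u0 v0 u1 v1 t : R) :
  univariate_penalty phi -> 0 <= a1 -> 0 <= a2 -> 0 < lambda ->
  lambda * a1 <= A -> lambda * a2 <= B -> 0 <= t <= 1 ->
  lambda * bivariate_penalty phi a1 a2
    (u0 + t * (u1 - u0)) (v0 + t * (v1 - v0)) <=
  lambda * (t * bivariate_penalty phi a1 a2 u1 v1 +
            (1 - t) * bivariate_penalty phi a1 a2 u0 v0) +
  t * (1 - t) * pair_form _ A B (u1 - u0) (v1 - v0).
Proof.
move=> pen a10 a20 l0 a1A a2B t01.
have chord := le_chord_bivariate_quad _ pen a1 a2 u0 v0 u1 v1 t a10 a20 t01.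
have /andP[t0 t1] := t01.
have abs_chord (a b : R) : `|a + t * (b - a)| <= t * `|b| + (1 - t) * `|a|.
  have -> : a + t * (b - a) = t * b + (1 - t) * a by ring.
  apply: le_trans (ler_normD _ _) _.
  by rewrite !normrM !(@ger0_norm _ t, @ger0_norm _ (1 - t))// subr_ge0.
have tt : 0 <= t * (1 - t) by rewrite mulr_ge0// subr_ge0.
rewrite /bivariate_penalty /pair_form.
move: chord (abs_chord u0 u1) (abs_chord v0 v1); rewrite /bivariate_quad /pair_form.
set U := u0 + t * _; set V := v0 + t * _.
set S := bivariate_S _ _ _ U V; set S1 := bivariate_S _ _ _ u1 v1.
set S0 := bivariate_S _ _ _ u0 v0.
move=> chord absU absV.
pose d1 := (u1 - u0) + (v1 - v0); pose d2 := (u1 - u0) - (v1 - v0).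
have S_le : S <= t * S1 + (1 - t) * S0 +
    t * (1 - t) * (a1 / 4 * d1 ^+ 2 + a2 / 4 * d2 ^+ 2).
  by move: chord; rewrite /U /V /d1 /d2; lra.
have main : lambda * (S + (`|U| + `|V|)) <= lambda * (t * (S1 + (`|u1| + `|v1|)) +
    (1 - t) * (S0 + (`|u0| + `|v0|)) +
    t * (1 - t) * (a1 / 4 * d1 ^+ 2 + a2 / 4 * d2 ^+ 2)).
  by rewrite ler_pM2l//; lra.
apply: le_trans main _; rewrite mulrDr lerD2l mulrCA ler_wpM2l// -/d1 -/d2.
have h1 := ler_wpM2r (sqr_ge0 d1) a1A.
have h2 := ler_wpM2r (sqr_ge0 d2) a2B.
lra.
Qed.

Lemma l2norm_sqr (u : int -> R) : l2norm u ^+ 2 = fine (isum (fun n => u n ^+ 2)).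
Proof. by rewrite sqr_sqrtr// fine_ge0// isum_ge0// => n; exact: sqr_ge0. Qed.

(** Moving the last term to the left makes both sides sums of nonnegative
    families, which may be compared term by term. *)
Lemma l2norm_sqr_chord (u v : int -> R) (t : R) : 0 <= t <= 1 ->
  (isum (fun n => (u n ^+ 2)%R) < +oo)%E ->
  (isum (fun n => (v n ^+ 2)%R) < +oo)%E ->
  (isum (fun n => ((u n - v n) ^+ 2)%R) < +oo)%E ->
  l2norm (fun n => t * u n + (1 - t) * v n) ^+ 2 =
  t * l2norm u ^+ 2 + (1 - t) * l2norm v ^+ 2 -
  t * (1 - t) * l2norm (fun n => u n - v n) ^+ 2.
Proof.
move=> /andP[t0 t1] uoo voo uvoo; rewrite !l2norm_sqr.
have {}t1 : 0 <= 1 - t by rewrite subr_ge0.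
have tt : 0 <= t * (1 - t) by exact: mulr_ge0.
pose w n := (t * u n + (1 - t) * v n) ^+ 2; rewrite -/w.
have u2 n : 0 <= u n ^+ 2 by exact: sqr_ge0.
have v2 n : 0 <= v n ^+ 2 by exact: sqr_ge0.
have uv2 n : 0 <= (u n - v n) ^+ 2 by exact: sqr_ge0.
have w2 n : 0 <= w n by exact: sqr_ge0.
have tu2 n : 0 <= t * u n ^+ 2 by exact: mulr_ge0.
have tv2 n : 0 <= (1 - t) * v n ^+ 2 by exact: mulr_ge0.
have tuv2 n : 0 <= t * (1 - t) * (u n - v n) ^+ 2 by exact: mulr_ge0.
have wE n : w n + t * (1 - t) * (u n - v n) ^+ 2 =
    t * u n ^+ 2 + (1 - t) * v n ^+ 2.
  by rewrite /w; ring.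
have isumE := isumD _ _ tu2 tv2.
have woo : (isum w < +oo)%E.
  apply: (isum_fin_le _ (fun n => t * u n ^+ 2 + (1 - t) * v n ^+ 2)) => [n|].
    by rewrite -wE lerDl.
  by rewrite isumE !isumZ// -EFinD ltry.
move: isumE; rewrite -(_ : isum (fun n => w n + t * (1 - t) * (u n - v n) ^+ 2) =
    isum _); last first.
  by congr isum; apply/funext => n; exact: wE.
rewrite isumD// !isumZ// (isum_fin w)// -!EFinD => -[].
lra.
Qed.

End Assembly.

Section Affine.
Context {R : realType}.

Lemma zero_pad_affine N (x z : 'rV[R]_N) (t : R) n :
  zero_pad (t *: x + (1 - t) *: z) n =
  zero_pad z n + t * (zero_pad x n - zero_pad z n).
Proof.
case: n => [|k] /=; first by rewrite subrr mulr0 addr0.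
by case: insubP => [i _ _|_]; rewrite ?mxE; ring.
Qed.

Lemma zero_padB N (x z : 'rV[R]_N) n :
  zero_pad (x - z) n = zero_pad x n - zero_pad z n.
Proof.
case: n => [|k] /=; first by rewrite subr0.
by case: insubP => [i _ _|_]; rewrite ?mxE ?subr0.
Qed.

Lemma convolution_affine (h : int -> R) N (x z : 'rV[R]_N) (t : R) n :
  convolution h (t *: x + (1 - t) *: z) n =
  t * convolution h x n + (1 - t) * convolution h z n.
Proof.
rewrite /convolution !mulr_sumr -big_split; apply: eq_bigr => k _ /=.
by rewrite !mxE; ring.
Qed.

Lemma convolutionB (h : int -> R) N (x z : 'rV[R]_N) n :
  convolution h (x - z) n = convolution h x n - convolution h z n.
Proof.
rewrite /convolution -sumrB; apply: eq_bigr => k _ /=.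
by rewrite !mxE mulrBr.
Qed.

Lemma isum_sqrB_fin (u v : int -> R) :
  (isum (fun n => (u n ^+ 2)%R) < +oo)%E ->
  (isum (fun n => (v n ^+ 2)%R) < +oo)%E ->
  (isum (fun n => ((u n - v n) ^+ 2)%R) < +oo)%E.
Proof.
move=> uoo voo.
apply: (isum_fin_le _ (fun n => 2 * u n ^+ 2 + 2 * v n ^+ 2)) => [n|].
  have := sqr_ge0 (u n + v n); lra.
have u2 n : 0 <= u n ^+ 2 by exact: sqr_ge0.
have v2 n : 0 <= v n ^+ 2 by exact: sqr_ge0.
have u2' n : 0 <= 2 * u n ^+ 2 by exact: mulr_ge0.
have v2' n : 0 <= 2 * v n ^+ 2 by exact: mulr_ge0.
by rewrite isumD// !isumZ// -EFinD ltry.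
Qed.

End Affine.

(** Along a chord the data term falls below linear interpolation by half of
    [t * (1 - t) * |H (x - z)|^2], and the penalty exceeds it by at most half of
    [t * (1 - t)] times the sum of [pair_form A B] over the neighbouring values
    of [x - z], which is smaller. *)
Lemma objective_chord (R : realType) (N : nat) (lambda : R) (h y : int -> R)
    (phi : R -> R -> R) (a1 a2 p0 p1 : R) (x z : 'rV[R]_N) (t : R) :
  0 < lambda -> abs_summable h -> sq_summable y -> univariate_penalty phi ->
  (forall w, trig_poly1 p0 p1 w <= Normc.normc (freq_response h w) ^+ 2) ->
  0 <= a1 <= trig_poly1 p0 p1 0 / lambda ->
  0 <= a2 <= trig_poly1 p0 p1 pi / lambda ->
  0 <= t <= 1 ->
  objective phi lambda a1 a2 h y (t *: x + (1 - t) *: z) <=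
  t * objective phi lambda a1 a2 h y x +
  (1 - t) * objective phi lambda a1 a2 h y z.
Proof.
move=> lambda_gt0 h_summable y_summable phi_penalty P_bounds.
move=> a1_bounds a2_bounds t01.
have h_fin : (isum (fun n => `|h n|%R) < +oo)%E by exact: h_summable.
have y_fin : (isum (fun n => (y n ^+ 2)%R) < +oo)%E.
  apply: le_lt_trans y_summable; apply: le_esum => n _.
  exact: lee_abs.
set A := trig_poly1 p0 p1 0 in a1_bounds.
set B := trig_poly1 p0 p1 pi in a2_bounds.
have /andP[a10 a1A] := a1_bounds; have /andP[a20 a2B] := a2_bounds.
rewrite ler_pdivlMr// mulrC in a1A; rewrite ler_pdivlMr// mulrC in a2B.
have P_le w : A * ((1 + cos w) / 2) + B * ((1 - cos w) / 2) <=
    Normc.normc (freq_response h w) ^+ 2.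
  apply: le_trans (P_bounds w).
  rewrite (_ : _ + _ = trig_poly1 p0 p1 w)// /A /B /trig_poly1 cos0 cospi.
  by field.
pose res (v : 'rV[R]_N) n := y n - convolution h v n.
have res_fin v : (isum (fun n => (res v n ^+ 2)%R) < +oo)%E.
  exact: isum_sqrB_fin y_fin (convolution_sq_fin _ _ h_fin v).
have resB n : res x n - res z n = - convolution h (x - z) n.
  by rewrite /res convolutionB; ring.
have energy := convolution_energy_ge _ _ h_fin A B (x - z) P_le.
have chord : l2norm (res (t *: x + (1 - t) *: z)) ^+ 2 =
    t * l2norm (res x) ^+ 2 + (1 - t) * l2norm (res z) ^+ 2 -
    t * (1 - t) * fine (isum (fun n => convolution h (x - z) n ^+ 2)).
  have -> : res (t *: x + (1 - t) *: z) =
      fun n => t * res x n + (1 - t) * res z n.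
    by apply/funext => n; rewrite /res convolution_affine; ring.
  rewrite (l2norm_sqr_chord _ _ _ t01)//.
    congr (_ - _ * _); rewrite l2norm_sqr; congr (fine (isum _)).
    by apply/funext => n; rewrite resB sqrrN.
  exact: isum_sqrB_fin.
pose pen (v : 'rV[R]_N) := \sum_(1 <= n < N.+2)
  bivariate_penalty phi a1 a2 (zero_pad v n.-1) (zero_pad v n).
have pen_chord : lambda * pen (t *: x + (1 - t) *: z) <=
    lambda * (t * pen x + (1 - t) * pen z) + t * (1 - t) *
    fine (isum (fun n => convolution h (x - z) n ^+ 2)).
  have /andP[t0 t1] := t01.
  apply: (@le_trans _ _ (lambda * (t * pen x + (1 - t) * pen z) + t * (1 - t) *
    \sum_(i < N.+1) pair_form _ A B (zero_pad (x - z) i) (zero_pad (x - z) i.+1)));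
        last first.
    by rewrite lerD2l ler_wpM2l// mulr_ge0// subr_ge0.
  have penE v : pen v = \sum_(i < N.+1)
      bivariate_penalty phi a1 a2 (zero_pad v i) (zero_pad v i.+1).
    by rewrite /pen big_add1 big_mkord.
  rewrite !penE !mulr_sumr -big_split mulr_sumr -big_split; apply: ler_sum => i _.
  rewrite !zero_pad_affine !zero_padB.
  exact: pair_penalty_chord.
rewrite /objective -/(res _) -/(res _) -/(res _) -/(pen _) -/(pen _) -/(pen _).
rewrite -/(res x) -/(res z) chord.
lra.
Qed.

Theorem theorem6 (R : realType) (N : nat) (lambda : R) (h y : int -> R)
    (phi : R -> R -> R) (a1 a2 p0 p1 : R)
    (N_gt2 : (2 < N)%N) (lambda_gt0 : 0 < lambda)
    (h_summable : abs_summable h) (y_summable : sq_summable y)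
    (phi_penalty : univariate_penalty phi)
    (P_bounds : forall w : R,
      0 <= trig_poly1 p0 p1 w <= Normc.normc (freq_response h w) ^+ 2)
    (a1_bounds : 0 <= a1 <= trig_poly1 p0 p1 0 / lambda)
    (a2_bounds : 0 <= a2 <= trig_poly1 p0 p1 pi / lambda) :
  convex_function [set: convex_lmodType 'rV[R]_N]
    (objective phi lambda a1 a2 h y (N := N)).
Proof.
have P_le w : trig_poly1 p0 p1 w <= Normc.normc (freq_response h w) ^+ 2.
  by case/andP: (P_bounds w).
move=> s x z _ _; apply: objective_chord P_le a1_bounds a2_bounds _ => //.
by apply/andP; split.
Qed.
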